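(* Let $s$ be a prime power, let $d=(s-1)(s+1)^2-1$, let $\beta=-1/s$, $k=s^2+s-1$ and $k'=s^3$. Let $\mathfrak{B}$ be the set of all $2$-dimensional affine subspaces (planes) of $\mathbb{F}_s^3$, and for $B\in\mathfrak{B}$ let $\mathbf{v}_B\in\{0,1\}^{s^3}$ be its characteristic vector (with respect to a fixed ordering of the $s^3$ points of $\mathbb{F}_s^3$). Define \[ \mathfrak{B}'=\{\varphi_{k}(\underbrace{1,\ldots,1}_{s-1},\underbrace{0,\ldots,0}_{s^2-2s},\mathbf{v}_B)\colon B\in\mathfrak{B}\}\subset T_d(k,\beta), \qquad \mathbf{x}_0=\varphi_{k'}(\underbrace{0,\ldots,0}_{s^2-s-1},\underbrace{1,\ldots,1}_{s^3})\in T_d(k',\beta). \] Then $R_d\cup\mathfrak{B}'\cup\{\mathbf{x}_0\}$ is a $2$-distance set in $H_d$ which is maximal, i.e. there is no $\mathbf{z}\in H_d\setminus(R_d\cup\mathfrak{B}'\cup\{\mathbf{x}_0\})$ such that $R_d\cup\mathfrak{B}'\cup\{\mathbf{x}_0,\mathbf{z}\}$ is still a $2$-distance set.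
   Context: For an integer $d\ge 2$, let $H_d=\{(x_1,\dots,x_{d+1})\in\mathbb{R}^{d+1}:\sum_i x_i=1\}$ (isometric to $\mathbb{R}^d$) with the Euclidean distance, and let $R_d=\{\mathbf{e}_1,\dots,\mathbf{e}_{d+1}\}$ be the standard basis vectors of $\mathbb{R}^{d+1}$ (a regular simplex in $H_d$ with all distances $\sqrt2$). A finite set is an $m$-distance set if the number of distinct distances between distinct points of it is exactly $m$. For an integer $1\le k\le d+1$ and real $\beta$, put $c_k=(1-(d+1-k)\beta)/(d+1)$ and $T_d(k,\beta)=\{\mathbf{x}\in H_d: x_i\in\{c_k,c_k+\beta\}\text{ for all }i,\ |\{i:x_i=c_k\}|=k\}$. For a $0/1$ vector $\mathbf{u}\in\{0,1\}^{d+1}$ with exactly $k$ ones, $\varphi_k(\mathbf{u})\in T_d(k,\beta)$ denotes the point whose $i$-th coordinate is $c_k$ if $u_i=1$ and $c_k+\beta$ if $u_i=0$. Here the vectors $(1,\ldots,1,0,\ldots,0,\mathbf{v}_B)$ have length $d+1$ and exactly $k$ ones, and the vector defining $\mathbf{x}_0$ has length $d+1$ and exactly $k'$ ones. *)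

(* Defs.v *)
From HB Require Import structures.
From mathcomp Require Import all_boot all_order all_algebra.
From mathcomp Require Import all_classical all_reals.
From mathcomp Require Import finfield zify ring.

Set Implicit Arguments.
Unset Strict Implicit.
Unset Printing Implicit Defensive.

Import Order.TTheory GRing.Theory Num.Theory.
Local Open Scope classical_set_scope.
Local Open Scope ring_scope.

Definition prime_power (s : nat) : Prop :=
  exists p n : nat, [/\ prime p, (0 < n)%N & s = (p ^ n)%N].

Section Distance.
Variables (R : realType) (n : nat).

(* The library norm on row vectors is the sup norm, hence this definition. *)
Definition edist (x y : 'rV[R]_n) : R :=
  Num.sqrt (\sum_(i < n) (x 0 i - y 0 i) ^+ 2).

Definition distances (X : set 'rV[R]_n) : set R :=
  [set r | exists x y, [/\ X x, X y, x <> y & r = edist x y]].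

Definition distance_set (m : nat) (X : set 'rV[R]_n) : Prop :=
  finite_set X /\ (distances X #= `I_m)%card.

End Distance.

Section Simplex.
Variables (R : realType) (d : nat).

Definition Hd : set 'rV[R]_d.+1 := [set x | \sum_(i < d.+1) x 0 i = 1].

Definition Rd : set 'rV[R]_d.+1 := range (fun i : 'I_d.+1 => delta_mx 0 i).

Definition ck (k : nat) (beta : R) : R :=
  (1 - (d.+1%:R - k%:R) * beta) / d.+1%:R.

Definition Td (k : nat) (beta : R) : set 'rV[R]_d.+1 :=
  [set x | [/\ Hd x,
               forall i, x 0 i = ck k beta \/ x 0 i = ck k beta + beta
             & #|[pred i | x 0 i == ck k beta]| = k]].

(* A 0/1 vector is a bitseq, so that vectors can be concatenated with ++; it is
   meant to have size d.+1. *)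
Definition phi (k : nat) (beta : R) (u : bitseq) : 'rV[R]_d.+1 :=
  \row_(i < d.+1) (if nth false u i then ck k beta else ck k beta + beta).

Definition maximal_distance_set (m : nat) (X : set 'rV[R]_d.+1) : Prop :=
  [/\ X `<=` Hd, distance_set m X
    & ~ exists z, (Hd `\` X) z /\ distance_set m (X `|` [set z])].

End Simplex.

Arguments Hd R d : clear implicits.
Arguments Rd R d : clear implicits.
Arguments Td {R} d k beta.

Section AffineSpace.
Variable F : finFieldType.

Definition affine_subspace (n r : nat) (B : {set 'rV[F]_n}) : Prop :=
  exists (a : 'rV[F]_n) (W : {vspace 'rV[F]_n}),
    \dim W = r /\ forall x, (x \in B) = (x - a \in W).

Definition planes : set {set 'rV[F]_3} := [set B | affine_subspace 2 B].

Definition ordering (pts : seq 'rV[F]_3) : Prop :=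
  perm_eq pts (enum {: 'rV[F]_3}).

Definition char_vec (pts : seq 'rV[F]_3) (B : {set 'rV[F]_3}) : bitseq :=
  [seq x \in B | x <- pts].

Definition block_word (s : nat) (pts : seq 'rV[F]_3) (B : {set 'rV[F]_3}) :
    bitseq :=
  nseq (s - 1) true ++ nseq (s ^ 2 - 2 * s) false ++ char_vec pts B.

End AffineSpace.

Definition x0_word (s : nat) : bitseq :=
  nseq (s ^ 2 - s - 1) false ++ nseq (s ^ 3) true.

Definition Bprime (R : realType) (F : finFieldType) (d s k : nat) (beta : R)
    (pts : seq 'rV[F]_3) : set 'rV[R]_d.+1 :=
  [set phi d k beta (block_word s pts B) | B in @planes F].

Definition x0 (R : realType) (d s k' : nat) (beta : R) : 'rV[R]_d.+1 :=
  phi d k' beta (x0_word s).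

Arguments Bprime {R F} d s k beta pts.

Lemma phi_Td (R : realType) (d k : nat) (beta : R) (u : bitseq) :
  beta != 0 -> size u = d.+1 -> count id u = k -> Td d k beta (phi d k beta u).
Proof.
move=> b0 su cu.
have cuE : (\sum_(i < d.+1) (nth false u i : nat) = k)%N.
  rewrite -cu -sumn_count sumnE big_map (big_nth false) su big_mkord.
  by apply: eq_bigr => i _.
split.
- rewrite /Hd /=.
  have -> : \sum_(i < d.+1) phi d k beta u 0 i =
      \sum_(i < d.+1) (ck d k beta + beta - (nth false u i : nat)%:R * beta).
    by apply: eq_bigr => i _; rewrite mxE; case: nth;
      rewrite ?mul1r ?mul0r ?subr0 ?addrK.
  rewrite sumrB sumr_const card_ord -mulr_suml -natr_sum cuE /ck.
  rewrite -[X in X - _]mulr_natl mulrDr mulrCA divff ?pnatr_eq0 // mulr1.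
  ring.
- by move=> i; rewrite mxE; case: nth; [left|right].
rewrite -[RHS]cuE -sum1_card big_mkcond /=.
apply: eq_bigr => i _; rewrite inE mxE; case: nth; rewrite ?eqxx //.
by rewrite -subr_eq0 addrAC subrr add0r (negbTE b0).
Qed.

Lemma size_points (F : finFieldType) (pts : seq 'rV[F]_3) :
  ordering pts -> size pts = (#|F| ^ 3)%N.
Proof. by move/perm_size->; rewrite -cardE card_mx. Qed.

Lemma dim_eq s : (1 < s)%N ->
  ((s - 1) * (s + 1) ^ 2 - 1).+1 = (s ^ 2 - s - 1 + s ^ 3)%N.
Proof. by move=> s1; nia. Qed.

Lemma size_x0_word s : (1 < s)%N ->
  size (x0_word s) = ((s - 1) * (s + 1) ^ 2 - 1).+1.
Proof. by move=> s1; rewrite dim_eq // size_cat !size_nseq. Qed.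

Lemma count_x0_word s : count id (x0_word s) = (s ^ 3)%N.
Proof. by rewrite count_cat !count_nseq /= mul0n mul1n. Qed.

Lemma size_block_word (F : finFieldType) (pts : seq 'rV[F]_3) B :
  ordering pts ->
  size (block_word #|F| pts B) = ((#|F| - 1) * (#|F| + 1) ^ 2 - 1).+1.
Proof.
move=> o; have s1 : (1 < #|F|)%N := card_finNzRing_gt1 F.
by rewrite dim_eq // !size_cat !size_nseq size_map size_points //; nia.
Qed.

Lemma count_block_word (F : finFieldType) (pts : seq 'rV[F]_3) B :
  ordering pts -> planes B ->
  count id (block_word #|F| pts B) = (#|F| ^ 2 + #|F| - 1)%N.
Proof.
move=> o [a [W [dW BW]]]; have s1 : (1 < #|F|)%N := card_finNzRing_gt1 F.
have cB : #|B| = (#|F| ^ 2)%N.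
  have := @card_vspace F 'rV[F]_3 _ W; rewrite dW => <-.
  rewrite -(card_imset _ (addIr (- a))).
  apply: eq_card => y; apply/imsetP/idP => [[x + ->]|yW].
    by rewrite BW.
  by exists (y + a); rewrite ?BW addrK.
rewrite !count_cat !count_nseq /= count_map.
rewrite (permP o) -size_filter.
rewrite (_ : size _ = #|B|); first by
  rewrite cB mul1n mul0n add0n addnC addnBA // ltnW.
by rewrite cardE !enumT /enum_mem; congr size; apply: eq_filter.
Qed.

Lemma Bprime_sub_Td (R : realType) (F : finFieldType) (pts : seq 'rV[F]_3) :
  let s := #|F| in let d := ((s - 1) * (s + 1) ^ 2 - 1)%N in
  let k := (s ^ 2 + s - 1)%N in let beta : R := - (s%:R)^-1 in
  ordering pts -> Bprime d s k beta pts `<=` Td d k beta.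
Proof.
move=> s d k beta o _ [B BP <-]; apply: phi_Td.
- by rewrite oppr_eq0 invr_eq0 pnatr_eq0 -lt0n ltnW // card_finNzRing_gt1.
- exact: size_block_word.
- exact: count_block_word.
Qed.

Lemma x0_Td (R : realType) (s : nat) :
  let d := ((s - 1) * (s + 1) ^ 2 - 1)%N in
  let k' := (s ^ 3)%N in let beta : R := - (s%:R)^-1 in
  (1 < s)%N -> Td d k' beta (x0 d s k' beta).
Proof.
move=> d k' beta s1; apply: phi_Td.
- by rewrite oppr_eq0 invr_eq0 pnatr_eq0 -lt0n ltnW.
- exact: size_x0_word.
- exact: count_x0_word.
Qed.

(* Main.v *)
(* All squared distances are [2] or [2 - 2/s]. Two points coded by 0/1 words of
   weights [k] and [l] are at squared distance
   [beta^2 (k + l - 2 I - (k - l)^2 / (d + 1))], where [I] is the overlap of the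
   words, so everything reduces to counting incidences.

   Maximality: a further point [z] has only two distances to the simplex, so it is
   coded by a 0/1 word [u], and its weight solves a quadratic equation whose roots
   are exactly [k] and [k']. Weight [k'] is excluded because the distance to [x0]
   would force too many ones outside the last [s^3] coordinates. For weight [k],
   let [S] be the subset of the affine space coded by the last [s^3] coordinates of
   [u]. The distance to [x0] gives [#|S| = s^2] or [s^2 - s], and the distances to
   the blocks say that every plane meets [S] in [t] or [t + s] points for a fixed
   [t < s]. Computing the second moment of the plane intersections in two ways
   rules this out. *)

Require Import Defs.
From mathcomp Require Import all_boot all_order all_algebra.
From mathcomp Require Import all_classical all_reals.
From mathcomp Require Import finmap finfield zify ring lra.

Set Implicit Arguments.
Unset Strict Implicit.
Unset Printing Implicit Defensive.

Import Order.TTheory GRing.Theory Num.Theory.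
Local Open Scope ring_scope.

(** * Planes of the affine space [F^3] and their intersections with a fixed set *)

Section Planes.
Variable F : finFieldType.
Implicit Types (w x y : 'rV[F]_3) (c : F).

Definition dotp w x : F := (x *m w^T) 0 0.

Lemma dotp0l x : dotp 0 x = 0.
Proof. by rewrite /dotp trmx0 mulmx0 mxE. Qed.

Lemma dotpC w x : dotp w x = dotp x w.
Proof. by rewrite /dotp -[x *m _]trmxK trmx_mul trmxK mxE. Qed.

Lemma dotpB w x y : dotp w (x - y) = dotp w x - dotp w y.
Proof. by rewrite /dotp mulmxBl !mxE. Qed.

Lemma dotp_surj w c : w != 0 -> exists x, dotp w x = c.
Proof.
move=> /rV0Pn[i wi].
exists ((c / w 0 i) *: delta_mx 0 i).
by rewrite /dotp -scalemxAl -rowE !mxE divfK.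
Qed.

Definition dotp_lfun w : 'Hom('rV[F]_3, 'rV[F]_1) := linfun (mulmxr w^T).

Definition normal_space w : {vspace 'rV[F]_3} := lker (dotp_lfun w).

Lemma mem_normal_space w x : (x \in normal_space w) = (dotp w x == 0).
Proof.
rewrite memv_ker lfunE /= /dotp; apply/eqP/eqP => [->|h]; first by rewrite mxE.
by apply/matrixP => i j; rewrite !ord1 h mxE.
Qed.

(** Rank-nullity: for [w != 0] the form [dotp w] is nonzero, so its image is the whole
    one-dimensional target. *)
Lemma dim_normal_space w : w != 0 -> \dim (normal_space w) = 2%N.
Proof.
move=> w0; have := limg_ker_dim (dotp_lfun w) fullv.
rewrite capfv dimvf /dim /= mul1n.
suff -> : \dim (limg (dotp_lfun w)) = 1%N by rewrite addn1 => -[].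
apply/eqP; rewrite eqn_leq (leq_trans (dimvS (subvf _))) ?dimvf //=.
have [x wx] := dotp_surj 1 w0.
rewrite lt0n dimv_eq0; apply: contra_eq_neq wx => h; rewrite /dotp.
suff : x *m w^T \in (0%VS : {vspace 'rV[F]_1}).
  by rewrite memv0 => /eqP ->; rewrite mxE eq_sym oner_eq0.
by rewrite -h; have := memv_img (dotp_lfun w) (memvf x); rewrite lfunE.
Qed.

Definition level_plane w c : {set 'rV[F]_3} := [set x | dotp w x == c].

Lemma level_plane_planes w c : w != 0 -> planes (level_plane w c).
Proof.
move=> w0; have [a wa] := dotp_surj c w0.
exists a, (normal_space w); split; first exact: dim_normal_space.
by move=> x; rewrite inE mem_normal_space dotpB wa subr_eq0.
Qed.

Lemma card_orthogonal w : w != 0 -> #|[set x | dotp x w == 0]| = (#|F| ^ 2)%N.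
Proof.
move=> w0; have := @card_vspace F 'rV[F]_3 _ (normal_space w).
rewrite dim_normal_space // => <-.
by apply: eq_card => x; rewrite inE mem_normal_space dotpC.
Qed.

(** Seen from a common point [p], both planes are translates of their direction spaces. If these
    spanned only dimension 2 they would coincide, and so would the planes; hence they span dimension
    3 and meet in a line. *)
Lemma card_planes_inter (B C : {set 'rV[F]_3}) :
  planes B -> planes C -> B != C -> #|B :&: C| = 0%N \/ #|B :&: C| = #|F|.
Proof.
move=> [a [V [dV BV]]] [b [W [dW CW]]] neqBC.
have [->|[p]] := set_0Vmem (B :&: C); first by left; rewrite cards0.
rewrite inE => /andP[]; rewrite BV CW => pV pW; right.
have {}BV x : (x \in B) = (x - p \in V).
  by rewrite BV -(subrKA p) rpredDr.
have {}CW x : (x \in C) = (x - p \in W).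
  by rewrite CW -(subrKA p) rpredDr.
have cardI : #|B :&: C| = #|(V :&: W)%VS|.
  rewrite -(card_imset _ (addIr (- p))); apply: eq_card => y.
  rewrite memv_cap; apply/imsetP/idP => [[x + ->]|yVW].
    by rewrite inE BV CW.
  by exists (y + p); rewrite ?inE ?BV ?CW addrK.
rewrite cardI card_vspace; suff -> : \dim (V :&: W) = 1%N by rewrite expn1.
have := dimv_sum_cap V W; rewrite dV dW.
have : (\dim (V + W) <= 3)%N by rewrite (leq_trans (dimvS (subvf _))) // dimvf.
have : (\dim (V + W) != 2)%N.
  apply: contra_neqN neqBC => /eqP dVW.
  have eqV : V = (V + W)%VS by apply/eqP; rewrite eqEdim addvSl dV dVW.
  have eqW : W = (V + W)%VS by apply/eqP; rewrite eqEdim addvSr dW dVW.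
  by apply/setP => x; rewrite BV CW eqV [in RHS]eqW.
have := dimvS (addvSl V W); rewrite dV.
lia.
Qed.

Variable S : {set 'rV[F]_3}.

Lemma sum_card_level_plane w :
  (\sum_c #|S :&: level_plane w c| = #|S|)%N.
Proof.
under eq_bigr => c _ do rewrite -sum1_card.
rewrite -[RHS]sum1_card (partition_big (dotp w) xpredT) //=.
by apply: eq_bigr => c _; apply: eq_bigl => x; rewrite !inE.
Qed.

Lemma sum_card_level_plane_sqr w :
  (\sum_c #|S :&: level_plane w c| ^ 2 =
   \sum_(x in S) \sum_(y in S) (dotp w x == dotp w y))%N.
Proof.
transitivity (\sum_c \sum_(x in S | dotp w x == c)
                \sum_(y in S) (dotp w x == dotp w y))%N.
  apply: eq_bigr => c _; rewrite -mulnn -{1}sum1_card big_distrl /=.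
  apply: eq_big => [x|x]; rewrite !inE // => /andP[_ /eqP wx].
  rewrite mul1n -sum1_card big_mkcond [RHS]big_mkcond /=.
  by apply: eq_bigr => y _; rewrite !inE wx [c == _]eq_sym;
    case: (y \in S); case: eqP.
by rewrite [RHS](partition_big (dotp w) xpredT).
Qed.

(** Double counting of the triples [(w, x, y)] with [x, y] in [S] and [w.x = w.y]. The normal
    [w = 0] accounts for the extra [#|S| ^ 2]; a pair [x = y] admits all [s^3] normals, and a pair
    [x != y] the [s^2] normals orthogonal to [x - y]. *)
Lemma sum_card_level_planes_sqr :
  (\sum_(w : 'rV[F]_3 | w != 0%R) \sum_c #|S :&: level_plane w c| ^ 2 + #|S| ^ 2 =
   #|S| * #|F| ^ 3 + #|S| * (#|S| - 1) * #|F| ^ 2)%N.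
Proof.
under eq_bigr => w _ do rewrite sum_card_level_plane_sqr.
have -> : (#|S| ^ 2 = \sum_(x in S) \sum_(y in S) (dotp 0%R x == dotp 0%R y))%N.
  rewrite -mulnn -{1}sum1_card big_distrl /=; apply: eq_bigr => x _.
  by rewrite mul1n -sum1_card; apply: eq_bigr => y _; rewrite !dotp0l eqxx.
transitivity (\sum_(w : 'rV[F]_3) \sum_(x in S) \sum_(y in S)
                (dotp w x == dotp w y))%N.
  by rewrite [RHS](bigD1 (0%R : 'rV[F]_3)) //= addnC.
rewrite exchange_big /=.
rewrite -mulnA -mulnDr -sum_nat_const; apply: eq_bigr => x Sx.
rewrite exchange_big /= (bigD1 x) //=; congr addn.
  under eq_bigr => w _ do rewrite eqxx.
  by rewrite sum1_card card_mx mul1n.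
transitivity (\sum_(y in S | y != x) #|F| ^ 2)%N.
  apply: eq_bigr => y /andP[_ yx]; rewrite -(@card_orthogonal (x - y)).
    rewrite -sum1_card [RHS]big_mkcond /=; apply: eq_bigr => w _.
    by rewrite inE dotpB subr_eq0; case: eqP.
  by rewrite subr_eq0 eq_sym.
rewrite sum_nat_const; congr muln; rewrite (cardsD1 x S) Sx addKn.
by apply: eq_card => y; rewrite !inE andbC.
Qed.

End Planes.

(* If [#|S :&: B|] takes only the values [t] and [t + s], its square is an affine
   function of it, so its second moment over the planes [w.x = c], [w != 0], is
   determined by [#|S|] and [t]. *)
Lemma no_two_intersection_set (F : finFieldType) (S : {set 'rV[F]_3}) (t : nat)
    (s := #|F|) :
  (t < s)%N ->
  (forall B, planes B -> #|S :&: B| = t \/ #|S :&: B| = (t + s)%N) ->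
  #|S| != (s ^ 2)%N /\ #|S| != (s ^ 2 - s)%N.
Proof.
move=> ts HB; have s1 : (1 < s)%N := card_finNzRing_gt1 F.
(* For [n = #|S :&: B|] this is [(n - t)(n - t - s) = 0], written without subtraction and summed
   over the [s] parallel planes with normal [w]. *)
have sumE w : w != 0 ->
    (\sum_c #|S :&: level_plane w c| ^ 2 + s * (t * (t + s)) =
     (2 * t + s) * #|S|)%N.
  move=> w0; rewrite -(sum_card_level_plane S w) big_distrr /= -sum_nat_const.
  rewrite -big_split /=; apply: eq_bigr => c _.
  by case: (HB _ (level_plane_planes c w0)) => ->; ring.
have card_normals : #|[pred w : 'rV[F]_3 | w != 0]| = (s ^ 3 - 1)%N.
  have := cardC1 (0 : 'rV[F]_3); rewrite card_mx subn1 => <-.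
  by apply: eq_card => w; rewrite !inE.
have := sum_card_level_planes_sqr S; rewrite -/s.
have : (\sum_(w : 'rV[F]_3 | w != 0%R)
          (\sum_c #|S :&: level_plane w c| ^ 2 + s * (t * (t + s))) =
        (s ^ 3 - 1) * ((2 * t + s) * #|S|))%N.
  by rewrite (eq_bigr _ sumE) sum_nat_const card_normals.
rewrite big_split /= sum_nat_const card_normals.
move: (\sum_(w | _) _)%N => M; move: #|S| => q {HB sumE card_normals}.
move: s s1 ts => s s1 ts.
move=> h1 h2.
have h : (((s ^ 3 - 1) * ((2 * t + s) * q) + q ^ 2 =
   (s ^ 3 - 1) * (s * (t * (t + s))) + (q * s ^ 3 + q * (q - 1) * s ^ 2)))%N by lia.
move: h => {h1 h2 M}; case: q => [|q] h; first by split; apply/eqP; clear -s1; nia.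
(* Over the integers the subtractions are no longer truncated. *)
have {}h : ((s%:Z ^+ 3 - 1) * ((2 * t%:Z + s%:Z) * q.+1%:Z) + q.+1%:Z ^+ 2 =
   (s%:Z ^+ 3 - 1) * (s%:Z * (t%:Z * (t%:Z + s%:Z))) +
   (q.+1%:Z * s%:Z ^+ 3 + q.+1%:Z * (q.+1%:Z - 1) * s%:Z ^+ 2)).
  have s3 : (0 < s ^ 3)%N by rewrite expn_gt0 ltnW.
  lia.
have ss : (s <= s ^ 2)%N by rewrite -{1}[s]expn1 leq_exp2l.
have ns : s%:Z * (s%:Z - 1) != 0 by rewrite mulf_neq0 //; lia.
split; apply/eqP => E.
  (* The relation becomes [t(s - t)(s^2 + s + 1) = s^2(s - 1)]. The left side vanishes for [t = 0];
     for [0 < t < s] it is too large, since [t(s - t) >= s - 1]. *)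
  have {}E : q.+1%:Z = s%:Z ^+ 2 by lia.
  have : s%:Z * (s%:Z - 1) * (t%:Z * (s%:Z - t%:Z) * (s%:Z ^+ 2 + s%:Z + 1)
           - s%:Z ^+ 2 * (s%:Z - 1)) = 0.
    by move: h; rewrite E => /eqP; rewrite -subr_eq0 => /eqP <-; ring.
  move=> /eqP; rewrite mulf_eq0 (negPf ns) /= subr_eq0 => /eqP {}h.
  have [t0|t0] := eqVneq t 0%N.
    by move: h; rewrite t0 !mul0r; clear -s1; nia.
  have : s%:Z - 1 <= t%:Z * (s%:Z - t%:Z) by clear -t0 ts; nia.
  by move: h; move: (t%:Z * _) => A; clear -s1; nia.
(* Here it becomes [2s(s - 1) = t(t - s + 2)(s^2 + s + 1)]. The right side is too large for
   [t = s - 1] and at most 0 for smaller [t]. *)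
have {}E : q.+1%:Z = s%:Z ^+ 2 - s%:Z by lia.
have : s%:Z * (s%:Z - 1) * (2 * s%:Z * (s%:Z - 1)
         - t%:Z * (t%:Z - s%:Z + 2) * (s%:Z ^+ 2 + s%:Z + 1)) = 0.
  by move: h; rewrite E => /eqP; rewrite -subr_eq0 => /eqP <-; ring.
move=> /eqP; rewrite mulf_eq0 (negPf ns) /= subr_eq0 => /eqP {}h.
have [t0|t0] := eqVneq t (s - 1)%N.
  have {}t0 : t%:Z = s%:Z - 1 by lia.
  by move: h; rewrite t0; clear -s1; nia.
have : t%:Z * (t%:Z - s%:Z + 2) <= 0 by clear -t0 ts; nia.
by move: h; move: (t%:Z * _) => A; clear -s1; nia.
Qed.

(** * Weights and overlaps of words, and squared distances between coded points *)

Definition weight (n : nat) (u : bitseq) : nat :=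
  (\sum_(i < n) nth false u i)%N.

Definition overlap (n : nat) (u v : bitseq) : nat :=
  (\sum_(i < n) (nth false u i && nth false v i))%N.

Lemma weight_count n u : size u = n -> weight n u = count id u.
Proof.
move=> su; rewrite -sumn_count sumnE big_map (big_nth false) su big_mkord.
by apply: eq_bigr => i _.
Qed.

(** Squared distances stay rational in [s]; square roots return only when passing to [edist]. *)
Definition sqdist (R : realType) n (x y : 'rV[R]_n) : R :=
  \sum_(i < n) (x 0 i - y 0 i) ^+ 2.

Section SquaredDistances.
Variables (R : realType) (d : nat).
Implicit Types (u v : bitseq) (x y z : 'rV[R]_d.+1).

Lemma sqdistC x y : sqdist x y = sqdist y x.
Proof. by apply: eq_bigr => i _; rewrite -sqrrN opprB. Qed.

Lemma sqdist_ge0 x y : 0 <= sqdist x y.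
Proof. by apply: sumr_ge0 => i _; rewrite sqr_ge0. Qed.

Lemma sqdist_delta x i :
  sqdist x (delta_mx 0 i) = \sum_j x 0 j ^+ 2 + 1 - 2 * x 0 i.
Proof.
have term j : true -> (x 0 j - (delta_mx 0 i : 'rV[R]_d.+1) 0 j) ^+ 2 =
    x 0 j ^+ 2 + (if j == i then 1 - 2 * x 0 i else 0).
  move=> _; rewrite mxE eqxx /=; case: eqP => [->|_] /=; last by rewrite subr0 addr0.
  ring.
by rewrite /sqdist (eq_bigr _ term) big_split /= -big_mkcond big_pred1_eq addrA.
Qed.

Lemma sqdist_delta_delta i j : i != j ->
  sqdist (delta_mx 0 i : 'rV[R]_d.+1) (delta_mx 0 j) = 2.
Proof.
move=> ij; rewrite sqdist_delta mxE eq_sym (negPf ij) andbF mulr0 subr0.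
rewrite (bigD1 i) //= big1 => [|l li]; last by rewrite mxE (negPf li) expr0n.
by rewrite mxE !eqxx expr1n addr0.
Qed.

Variable beta : R.

Lemma phiE k u i :
  phi d k beta u 0 i = ck d k beta + beta - beta * (nth false u i)%:R.
Proof. by rewrite mxE; case: nth; rewrite ?mulr1 ?mulr0 ?addrK ?subr0. Qed.

Lemma sqdist_phi u v (k := weight d.+1 u) (l := weight d.+1 v) :
  sqdist (phi d k beta u) (phi d l beta v) =
  beta ^+ 2 * (k%:R + l%:R - 2 * (overlap d.+1 u v)%:R
               - (k%:R - l%:R) ^+ 2 / d.+1%:R).
Proof.
pose e := ck d k beta - ck d l beta.
(* The coordinate difference is [e - beta (u_i - v_i)]. Bits are idempotent, so its square is affine
   in [u_i], [v_i] and [u_i && v_i]. *)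
have term (i : 'I_d.+1) : true ->
    (phi d k beta u 0 i - phi d l beta v 0 i) ^+ 2 = e ^+ 2 +
    (beta ^+ 2 - 2 * e * beta) * (nth false u i)%:R +
    (beta ^+ 2 + 2 * e * beta) * (nth false v i)%:R -
    2 * beta ^+ 2 * (nth false u i && nth false v i)%:R.
  by move=> _; rewrite !phiE /e; do 2!case: nth => /=; ring.
rewrite /sqdist (eq_bigr _ term) !big_split /= sumrN sumr_const card_ord.
rewrite -!mulr_sumr -!natr_sum -/(weight _ u) -/(weight _ v) -/(overlap _ u v).
rewrite -/k -/l -[e ^+ 2 *+ _]mulr_natl /e /ck.
have : d.+1%:R != 0 :> R by rewrite pnatr_eq0.
by move: d.+1%:R => n n0; field.
Qed.

Lemma sqnorm_phi u (k := weight d.+1 u) :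
  \sum_i phi d k beta u 0 i ^+ 2 =
  k%:R * ck d k beta ^+ 2 + (d.+1%:R - k%:R) * (ck d k beta + beta) ^+ 2.
Proof.
have term (i : 'I_d.+1) : true ->
    phi d k beta u 0 i ^+ 2 = (ck d k beta + beta) ^+ 2 +
    (ck d k beta ^+ 2 - (ck d k beta + beta) ^+ 2) * (nth false u i)%:R.
  by move=> _; rewrite phiE; case: nth => /=; ring.
rewrite (eq_bigr _ term) !big_split /= sumr_const card_ord -!mulr_sumr.
by rewrite -!natr_sum -/(weight _ u) -/k -[_ *+ d.+1]mulr_natl; ring.
Qed.

End SquaredDistances.

(** * Points with two prescribed distances to the simplex *)

Section DistancesToSimplex.
Variables (R : realType) (d s : nat).
Hypothesis s_gt0 : (0 < s)%N.
Let beta : R := - (s%:R)^-1.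

(* The condition on [m] under which the points of [Td d m beta] have squared
   distances [2] and [2 - 2 / s] to the simplex. *)
Definition good_weight (m : nat) :=
  (m%:R - s%:R) ^+ 2 = d.+1%:R * (m%:R - s%:R ^+ 2) :> R.

Let s0 : s%:R != 0 :> R. Proof. by rewrite pnatr_eq0 -lt0n. Qed.
Let n0 : d.+1%:R != 0 :> R. Proof. by rewrite pnatr_eq0. Qed.

Lemma sqdist_phi_delta u i (m := weight d.+1 u) : good_weight m ->
  sqdist (phi d m beta u) (delta_mx 0 i) = 2 - 2 / s%:R * (nth false u i)%:R.
Proof.
rewrite /good_weight => mE.
rewrite sqdist_delta sqnorm_phi phiE -/m /ck /beta.
apply/eqP; rewrite -subr_eq0; apply/eqP.
(* The difference of the two sides is a multiple of the defect in the equation [good_weight]. *)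
transitivity (- ((m%:R - s%:R) ^+ 2 - d.+1%:R * (m%:R - s%:R ^+ 2)) /
    (d.+1%:R * s%:R ^+ 2) : R); last by rewrite mE subrr oppr0 mul0r.
by field; rewrite s0 nat1r n0.
Qed.

(** The squared distance to the [i]-th vertex is [Q + 1 - 2 z_i], with [Q] the squared norm of [z].
    So [z_i] is [a] or [a + 1/s], and [u] marks the vertices at the smaller distance. *)
Lemma phi_of_sqdist (z : 'rV[R]_d.+1) : Hd R d z ->
  (forall i, sqdist z (delta_mx 0 i) = 2 \/
             sqdist z (delta_mx 0 i) = 2 - 2 / s%:R) ->
  exists u, [/\ size u = d.+1, good_weight (weight d.+1 u) &
                z = phi d (weight d.+1 u) beta u].
Proof.
rewrite /Hd /= => zH zD.
pose u := mkseq (fun i => sqdist z (delta_mx 0 (inord i)) == 2 - 2 / s%:R) d.+1.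
exists u; set m := weight _ _.
pose Q := \sum_j z 0 j ^+ 2; pose a := (Q - 1) / 2.
have zE i : z 0 i = a + (nth false u i)%:R / s%:R.
  rewrite nth_mkseq ?ltn_ord // inord_val.
  have := zD i; rewrite sqdist_delta -/Q.
  have nz : 2 - 2 / s%:R != 2 :> R.
    by rewrite -subr_eq0 addrAC subrr add0r oppr_eq0 mulf_eq0 invr_eq0
      (negPf s0) pnatr_eq0.
  case=> h; rewrite h ?eqxx; [rewrite eq_sym (negPf nz)|]; rewrite /a /=.
    lra.
  move: h; rewrite div1r; lra.
have sumz : d.+1%:R * a + m%:R / s%:R = 1.
  rewrite -[RHS]zH (eq_bigr _ (fun i _ => zE i)) big_split /= sumr_const card_ord.
  by rewrite -mulr_suml -natr_sum mulr_natl.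
have aE : a = (1 - m%:R / s%:R) / d.+1%:R.
  by rewrite -[X in (X - _) / _]sumz;
  field; rewrite s0 nat1r n0.
have QE : Q = d.+1%:R * a ^+ 2 + (2 * a / s%:R + s%:R ^- 2) * m%:R.
  have term (i : 'I_d.+1) : true -> z 0 i ^+ 2 = a ^+ 2 +
      (2 * a / s%:R + s%:R ^- 2) * (nth false u i)%:R.
    by move=> _; rewrite zE; case: nth => /=; field.
  rewrite /Q (eq_bigr _ term) !big_split /= sumr_const card_ord -!mulr_sumr.
  by rewrite -!natr_sum -/(weight _ u) -/m -[_ *+ d.+1]mulr_natl.
split; first by rewrite size_mkseq.
- rewrite /good_weight; apply/eqP; rewrite -subr_eq0; apply/eqP.
  (* [Q = 1 + 2 a] by the choice of [a]; comparing with [QE] gives the quadratic equation for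
     [m]. *)
  transitivity (d.+1%:R * s%:R ^+ 2 * (1 + 2 * a -
    (d.+1%:R * a ^+ 2 + (2 * a / s%:R + s%:R ^- 2) * m%:R))).
    by rewrite aE; field; apply/andP; split; rewrite ?nat1r ?s0 ?n0.
  by rewrite -QE /a; field.
- apply/rowP => i; rewrite phiE zE aE /ck /beta.
  by field; rewrite s0 nat1r n0.
Qed.

End DistancesToSimplex.

(** * Sets with exactly two elements *)

Section TwoDistances.
Local Open Scope classical_set_scope.

Lemma card_set2 (T : choiceType) (a b : T) : a != b -> ([set a; b] #= `I_2)%card.
Proof.
move=> ab.
have -> : [set a; b] = [set` [fset a; b]%fset].
  apply/seteqP; split => x /=; first by case=> ->; rewrite !inE eqxx ?orbT.
  by rewrite !inE => /orP[]/eqP ->; [left|right].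
by apply/card_eq_fsetP; rewrite cardfs2 ab.
Qed.

(** For maximality: two distances already realised leave no third value to an added point. *)
Lemma card2_sub (T : choiceType) (D : set T) (a b c : T) :
  (D #= `I_2)%card -> a != b -> D a -> D b -> D c -> c = a \/ c = b.
Proof.
move=> D2 ab Da Db Dc.
have fD : finite_set D by apply/finite_setP; exists 2%N.
have cD := card_fset_set D2.
have /fsubset_leqif_cards[_ ] : ([fset a; b] `<=` fset_set D)%fset.
  by apply/fsubsetP => x; rewrite !inE in_fset_set // => /orP[]/eqP->; exact: mem_set.
rewrite cD cardfs2 ab eqxx => /esym/eqP E.
have : c \in fset_set D by rewrite in_fset_set //; exact: mem_set.
by rewrite -E !inE => /orP[]/eqP; auto.
Qed.

End TwoDistances.

(** * Splitting a word into its head and the part indexed by affine points *)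

Section Words.
Variables (F : finFieldType) (pts : seq 'rV[F]_3).
Hypothesis hpts : ordering pts.
Let s := #|F|.
Let p := (s ^ 2 - s - 1)%N.
Let s1 : (1 < s)%N := card_finNzRing_gt1 F.
Implicit Types (u : bitseq) (B : {set 'rV[F]_3}).

(** The offset is the head length, [(s - 1) + (s^2 - 2s)] in a block word. *)
Definition support u : {set 'rV[F]_3} :=
  [set x | nth false u (#|F| ^ 2 - #|F| - 1 + index x pts)].

Lemma mem_pts x : x \in pts.
Proof. by rewrite (perm_mem hpts) mem_enum. Qed.

Lemma sum_points (f : nat -> nat) :
  (\sum_(i < p + s ^ 3) f i =
   \sum_(i < p) f i + \sum_x f (p + index x pts))%N.
Proof.
rewrite big_split_ord /=; congr addn.
have Upts : uniq pts by rewrite (perm_uniq hpts) enum_uniq.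
rewrite -(big_mkord xpredT (fun j => f (p + j)%N)) -(size_points hpts).
transitivity (\sum_(x <- pts) f (p + index x pts))%N.
  rewrite [RHS](big_nth 0) big_nat [RHS]big_nat; apply: eq_bigr => j /andP[_ jp].
  by rewrite index_uniq.
by rewrite (perm_big _ hpts) big_enum.
Qed.

Lemma weight_support u : weight (p + s ^ 3) u = (weight p u + #|support u|)%N.
Proof.
rewrite /weight (sum_points (fun i => nth false u i)); congr addn.
rewrite -sum1_card [RHS]big_mkcond; apply: eq_bigr => x _.
by rewrite inE; case: nth.
Qed.

Lemma nth_block_word_head B i :
  (i < p)%N -> nth false (block_word s pts B) i = (i < s - 1)%N.
Proof.
move=> ip; rewrite nth_cat size_nseq nth_nseq; case: ltnP => // si.
by rewrite nth_cat size_nseq nth_nseq; do 2!case: ltnP => //; nia.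
Qed.

Lemma nth_block_word_tail B x :
  nth false (block_word s pts B) (p + index x pts) = (x \in B).
Proof.
have pE : p = (s - 1 + (s ^ 2 - 2 * s))%N by rewrite /p; nia.
rewrite /block_word catA nth_cat size_cat !size_nseq -pE ltnNge leq_addr /= addKn.
by rewrite (nth_map 0) ?index_mem ?nth_index ?mem_pts.
Qed.

Lemma support_block_word B : support (block_word s pts B) = B.
Proof. by apply/setP => x; rewrite inE nth_block_word_tail. Qed.

(** In the head only the first [s - 1] coordinates count, as block words vanish on the rest of
    it. *)
Lemma overlap_block_word u B : overlap (p + s ^ 3) u (block_word s pts B) =
  (weight (s - 1) u + #|support u :&: B|)%N.
Proof.
rewrite /overlap (sum_points (fun i => nth false u i && nth false _ i)).
congr addn.
  rewrite /weight (big_ord_widen p (fun i => nth false u i : nat)); last first.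
    by rewrite /p; nia.
  rewrite [RHS]big_mkcond; apply: eq_bigr => i _.
  by rewrite nth_block_word_head //; case: nth; case: ltnP.
rewrite -sum1_card [RHS]big_mkcond; apply: eq_bigr => x _.
by rewrite nth_block_word_tail !inE; case: nth; case: (_ \in _).
Qed.

Lemma weight_block_word_head B : weight (s - 1) (block_word s pts B) = (s - 1)%N.
Proof.
rewrite -[RHS]card_ord -sum1_card; apply: eq_bigr => i _.
by rewrite nth_cat size_nseq nth_nseq ltn_ord.
Qed.

Lemma overlap_x0_word u : overlap (p + s ^ 3) u (x0_word s) = #|support u|.
Proof.
rewrite /overlap (sum_points (fun i => nth false u i && nth false _ i)).
rewrite big1 => [|i _]; last first.
  by rewrite nth_cat size_nseq ltn_ord nth_nseq if_same andbF.
rewrite add0n -sum1_card [RHS]big_mkcond; apply: eq_bigr => x _.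
rewrite nth_cat size_nseq ltnNge leq_addr /= addKn nth_nseq.
by rewrite -(size_points hpts) index_mem mem_pts inE andbT; case: nth.
Qed.

End Words.

Lemma weight_le n u : (weight n u <= n)%N.
Proof.
rewrite -[X in (_ <= X)%N]card_ord -sum1_card.
by apply: leq_sum => i _; apply: leq_b1.
Qed.

Lemma nth_x0_word s i : (s ^ 2 - s - 1 <= i < s ^ 2 - s - 1 + s ^ 3)%N ->
  nth false (x0_word s) i.
Proof.
move=> /andP[pi ip]; rewrite nth_cat size_nseq ltnNge pi /= nth_nseq.
by rewrite ltn_subLR // ip.
Qed.

(** * The configuration: its two distances, then its maximality *)

Section Configuration.
Variables (R : realType) (F : finFieldType) (pts : seq 'rV[F]_3).
Hypothesis hpts : ordering pts.
Let s := #|F|.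
Let d := ((s - 1) * (s + 1) ^ 2 - 1)%N.
Let k := (s ^ 2 + s - 1)%N.
Let k' := (s ^ 3)%N.
Let beta : R := - (s%:R)^-1.
Local Notation S := (s%:R : R).
Let s1 : (1 < s)%N := card_finNzRing_gt1 F.
Let dE : d.+1 = (s ^ 2 - s - 1 + s ^ 3)%N := dim_eq s1.
Let S0 : S != 0. Proof. by rewrite pnatr_eq0 -lt0n ltnW. Qed.
Let S1 : 1 < S. Proof. by rewrite ltr1n. Qed.

Let nE : d.+1%:R = (S - 1) * (S + 1) ^+ 2.
Proof.
have -> : d.+1 = ((s - 1) * (s + 1) ^ 2)%N by rewrite /d; nia.
by rewrite natrM natrX natrD natrB // (ltnW s1).
Qed.

Let kE : k%:R = S ^+ 2 + S - 1.
Proof. by rewrite /k natrB ?natrD ?natrX //; nia. Qed.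

Let k'E : k'%:R = S ^+ 3.
Proof. by rewrite natrX. Qed.

Lemma good_weight_k : good_weight R d s k.
Proof. by rewrite /good_weight nE kE; ring. Qed.

Lemma good_weight_k' : good_weight R d s k'.
Proof. by rewrite /good_weight nE k'E; ring. Qed.

Lemma good_weightP m : good_weight R d s m -> m = k \/ m = k'.
Proof.
rewrite /good_weight nE => h.
have : (m%:R - k%:R) * (m%:R - k'%:R) == 0 :> R.
  apply/eqP; transitivity ((m%:R - S) ^+ 2 - (S - 1) * (S + 1) ^+ 2 * (m%:R - S ^+ 2)).
    by rewrite kE k'E; ring.
  by rewrite h subrr.
by rewrite mulf_eq0 !subr_eq0 !eqr_nat => /orP[]/eqP; auto.
Qed.

Lemma weight_block_word B : planes B -> weight d.+1 (block_word s pts B) = k.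
Proof.
by move=> BP; rewrite weight_count ?count_block_word // size_block_word.
Qed.

Lemma weight_x0_word : weight d.+1 (x0_word s) = k'.
Proof. by rewrite weight_count ?count_x0_word // size_x0_word. Qed.

Lemma sqdist_phi_same_weight m u v :
  weight d.+1 u = m -> weight d.+1 v = m ->
  sqdist (phi d m beta u) (phi d m beta v) =
  2 * (m%:R - (overlap d.+1 u v)%:R) / S ^+ 2.
Proof.
move=> um vm; have := sqdist_phi d beta u v; rewrite um vm => ->.
by rewrite subrr expr0n mul0r subr0 /beta sqrrN exprVn; field.
Qed.

Lemma sqdist_phi_x0 u : weight d.+1 u = k ->
  sqdist (phi d k beta u) (x0 d s k' beta) =
  2 - 2 / S - 2 * (#|support pts u|%:R - S ^+ 2) / S ^+ 2.
Proof.
move=> uk; have := sqdist_phi d beta u (x0_word s).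
rewrite uk weight_x0_word /x0 => ->.
rewrite {1}dE (overlap_x0_word hpts) nE kE k'E /beta sqrrN exprVn.
by field; rewrite S0 !lt0r_neq0 //; move: S1; lra.
Qed.

Let q : R := 2 - 2 / S.

Lemma sqdist_phi_delta2 m u i : good_weight R d s m -> weight d.+1 u = m ->
  sqdist (phi d m beta u) (delta_mx 0 i) = 2 \/
  sqdist (phi d m beta u) (delta_mx 0 i) = q.
Proof.
move=> mg um; have := sqdist_phi_delta (ltnW s1) (u := u) i; rewrite um => -> //.
by case: nth; [right|left]; rewrite ?mulr1 ?mulr0 ?subr0.
Qed.

(** Disjoint planes give squared distance 2, planes meeting in a line give [q]. *)
Lemma sqdist_blocks B C : planes B -> planes C -> B != C ->
  sqdist (phi d k beta (block_word s pts B))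
         (phi d k beta (block_word s pts C)) = 2 \/
  sqdist (phi d k beta (block_word s pts B))
         (phi d k beta (block_word s pts C)) = q.
Proof.
move=> BP CP BC; rewrite sqdist_phi_same_weight ?weight_block_word //.
rewrite {1 2}dE (overlap_block_word hpts) // weight_block_word_head.
rewrite support_block_word //.
rewrite kE natrD natrB ?(ltnW s1) //.
by case: (card_planes_inter BP CP BC) => ->; [left|right]; rewrite ?/q; field.
Qed.

(** Read off from the overlap of a block word with itself, which is its weight
    [k = (s - 1) + #|B|]. *)
Lemma card_plane (B : {set 'rV[F]_3}) : planes B -> #|B| = (s ^ 2)%N.
Proof.
move=> BP; have := overlap_block_word hpts (block_word s pts B) B.
rewrite support_block_word // finset.setIid weight_block_word_head -/s -dE.
rewrite (_ : overlap _ _ _ = k); first by rewrite /k; lia.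
rewrite -(weight_block_word BP); apply: eq_bigr => i _; exact/congr1/andbb.
Qed.

Lemma sqdist_block_x0 B : planes B ->
  sqdist (phi d k beta (block_word s pts B)) (x0 d s k' beta) = q.
Proof.
move=> BP; rewrite sqdist_phi_x0 ?weight_block_word // support_block_word //.
by rewrite card_plane // natrX subrr mulr0 mul0r subr0.
Qed.

Local Open Scope classical_set_scope.

Let X : set 'rV[R]_d.+1 :=
  Rd R d `|` Bprime d s k beta pts `|` [set x0 d s k' beta].

Lemma config_sqdist x y : X x -> X y -> x <> y ->
  sqdist x y = 2 \/ sqdist x y = q.
Proof.
have x0_delta i := sqdist_phi_delta2 i good_weight_k' weight_x0_word.
move=> [[[i _ <-]|[B BP <-]]|->] [[[j _ <-]|[C CP <-]]|->] neq.
- left; apply: sqdist_delta_delta; apply: contra_notN neq => /eqP -> //.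
- by rewrite sqdistC; apply: (sqdist_phi_delta2 _ good_weight_k);
    apply: weight_block_word.
- by rewrite sqdistC; apply: x0_delta.
- by apply: (sqdist_phi_delta2 _ good_weight_k);
    apply: weight_block_word.
- by apply: sqdist_blocks => //; apply: contra_notN neq => /eqP ->.
- by right; apply: sqdist_block_x0.
- exact: x0_delta.
- by right; rewrite sqdistC; apply: sqdist_block_x0.
- by case: neq.
Qed.

Let q_ge0 : 0 <= q.
Proof. by rewrite /q subr_ge0 ler_pdivrMr; move: S1; lra. Qed.

Let q_neq2 : Num.sqrt 2 != Num.sqrt q.
Proof.
rewrite eqr_sqrt // /q -subr_eq0 opprB addrCA subrr addr0.
by rewrite mulf_eq0 invr_eq0 (negPf S0) pnatr_eq0.
Qed.

Let X_sqrt2 : distances X (Num.sqrt 2).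
Proof.
have ne : (ord0 : 'I_d.+1) != ord_max.
  by apply/eqP => /(congr1 val) /=; rewrite /d; nia.
exists (delta_mx 0 ord0), (delta_mx 0 ord_max); split.
- by left; left; exists ord0.
- by left; left; exists ord_max.
- move=> /rowP /(_ ord0); rewrite !mxE !eqxx /= (negPf ne) => /eqP.
  by rewrite oner_eq0.
- by rewrite /edist -/(sqdist _ _) sqdist_delta_delta.
Qed.

Let X_sqrtq : distances X (Num.sqrt q).
Proof.
(* The last coordinate carries a one of [x0_word], hence the smaller distance to its vertex. *)
pose i : 'I_d.+1 := ord_max.
have xi : nth false (x0_word s) i.
  apply: nth_x0_word; rewrite -ltnS /= -dE leqnn andbT dE.
  by rewrite -[X in (X < _)%N]addn0 ltn_add2l expn_gt0 ltnW.
have E : sqdist (x0 d s k' beta) (delta_mx 0 i) = q.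
  have := @sqdist_phi_delta R d s (ltnW s1) (x0_word s) i.
  rewrite weight_x0_word xi mulr1; apply; exact: good_weight_k'.
exists (x0 d s k' beta), (delta_mx 0 i); split.
- by right.
- by left; left; exists i.
- move=> eq0; move: E; rewrite eq0 /sqdist big1 => [|j _]; last first.
    by rewrite subrr expr0n.
  move=> /esym/eqP; rewrite /q subr_eq0 => /eqP h.
  have : 2 / S < 2 by rewrite ltr_pdivrMr; move: S1; lra.
  by rewrite -h ltxx.
- by rewrite /edist -/(sqdist _ _) E.
Qed.

Lemma config_distance_set : distance_set 2 X.
Proof.
split.
  rewrite !finite_setU; split; [split|] => //.
  - exact: finite_image.
  - exact: finite_image.
suff -> : distances X = [set Num.sqrt 2; Num.sqrt q] by apply: card_set2.
apply/seteqP; split => [r [x [y [Xx Xy xy ->]]]|r [->|->]] //.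
by rewrite /edist -/(sqdist x y); case: (config_sqdist Xx Xy xy) => ->; [left|right].
Qed.

Lemma config_sub_Hd : X `<=` Hd R d.
Proof.
move=> x [[[i _ <-]|Bx]|->].
- rewrite /Hd /= (bigD1 i) //= big1 => [|j ji]; rewrite mxE ?eqxx ?addr0 //.
  by rewrite (negPf ji).
- by have [] := Bprime_sub_Td hpts Bx.
- by have [] := x0_Td R s1.
Qed.

(** The difference [a - b] must be [s^2] or [s^2 - s]; the additive form avoids truncated
    subtraction. *)
Let sqdist_gap (a b : nat) :
  2 * (a%:R - b%:R) / S ^+ 2 = 2 \/ 2 * (a%:R - b%:R) / S ^+ 2 = q ->
  a = (b + s ^ 2)%N \/ (a + s = b + s ^ 2)%N.
Proof.
move=> h; have e : a%:R - b%:R = 2 * (a%:R - b%:R) / S ^+ 2 * (S ^+ 2 / 2).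
  by field.
case: h => h; rewrite h in e; [left|right]; apply/eqP; rewrite -(eqr_nat R).
  by rewrite natrD natrX addrC -subr_eq e; apply/eqP; field.
rewrite !natrD natrX -subr_eq0.
have -> : a%:R + S - (b%:R + S ^+ 2) = a%:R - b%:R - (S ^+ 2 - S) by ring.
by rewrite e /q; apply/eqP; field.
Qed.

Lemma config_maximal z : Hd R d z ->
  ~ (forall x, X x -> sqdist z x = 2 \/ sqdist z x = q).
Proof.
move=> zH zX.
have [|u [su mg zE]] := phi_of_sqdist (ltnW s1) zH.
  by move=> i; apply: zX; left; left; exists i.
have zx0 : sqdist z (x0 d s k' beta) = 2 \/ sqdist z (x0 d s k' beta) = q.
  by apply: zX; right.
have := weight_support hpts u; rewrite -dE -/s => wu.
have := weight_le (s ^ 2 - s - 1) u => wp.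
have [mE|mE] := good_weightP mg; rewrite mE in wu zE; last first.
  move: zx0; rewrite zE sqdist_phi_same_weight ?weight_x0_word //.
  (* The head would contain [s^2] or [s^2 - s] ones, but it has only [s^2 - s - 1] coordinates. *)
  move=> /sqdist_gap; rewrite {1 2}dE (overlap_x0_word hpts) wu.
  by move: wp; clear -s1; nia.
have card_supp : #|support pts u| = (s ^ 2)%N \/ #|support pts u| = (s ^ 2 - s)%N.
  have ss : (s <= s ^ 2)%N by rewrite -{1}[s]expn1 leq_exp2l.
  move: zx0; rewrite zE sqdist_phi_x0 //.
  (* Recast in the shape of [sqdist_gap], with [a = 2 s^2 - s] and [b] the size of the support. *)
  have -> : 2 - 2 / S - 2 * (#|support pts u|%:R - S ^+ 2) / S ^+ 2 =
      2 * ((2 * s ^ 2 - s)%:R - #|support pts u|%:R) / S ^+ 2.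
    by rewrite natrB ?natrM ?natrX; [field|lia].
  by move=> /sqdist_gap; lia.
have ws := weight_le (s - 1) u.
(* With [w] ones among the first [s - 1] coordinates, the distance to a block makes
   [k - w - #|S :&: B|] equal to [s^2] or [s^2 - s], where [S] is the support; hence
   [t = s - 1 - w]. *)
have [||ns1 ns2] :=
  @no_two_intersection_set F (support pts u) (s - 1 - weight (s - 1) u).
- by rewrite -/s; lia.
- move=> B BP; have : X (phi d k beta (block_word s pts B)).
    by left; right; exists B.
  move=> /zX; rewrite zE sqdist_phi_same_weight ?weight_block_word //.
  move=> /sqdist_gap; rewrite {1 2}dE (overlap_block_word hpts) -/s /k.
  by move: ws s1; clear; nia.
by case: card_supp => E; move: ns1 ns2; rewrite E eqxx.
Qed.

Lemma config_maximal_distance_set : maximal_distance_set 2 X.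
Proof.
split; [exact: config_sub_Hd|exact: config_distance_set|].
move=> [z [[zH zX] [_ D2]]]; apply: (config_maximal zH) => x Xx.
have sub : distances X `<=` distances (X `|` [set z]).
  by move=> r [a [b [Xa Xb ab ->]]]; exists a, b; split => //; left.
have Dzx : distances (X `|` [set z]) (edist z x).
  by exists z, x; split => //; [right|left|move=> zx; apply: zX; rewrite zx].
have := card2_sub D2 q_neq2 (sub _ X_sqrt2) (sub _ X_sqrtq) Dzx.
rewrite /edist -/(sqdist z x).
by case=> /eqP; rewrite eqr_sqrt ?sqdist_ge0 // => /eqP; auto.
Qed.

End Configuration.

Local Open Scope classical_set_scope.

Theorem theorem3p9 (R : realType) (s d k k' : nat) (beta : R)
    (F : finFieldType) (pts : seq 'rV[F]_3)
    (hs : prime_power s)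
    (hF : #|F| = s)
    (hpts : ordering pts)
    (hd : d = ((s - 1) * (s + 1) ^ 2 - 1)%N)
    (hbeta : beta = - (s%:R)^-1)
    (hk : k = (s ^ 2 + s - 1)%N)
    (hk' : k' = (s ^ 3)%N) :
  maximal_distance_set 2
    (Rd R d `|` Bprime d s k beta pts `|` [set x0 d s k' beta]).
Proof. by subst; apply: config_maximal_distance_set. Qed.
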